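(* Let $H=(V,E)$ and $A=(Q,C)$ be finite simple undirected graphs with $|V|=|Q|$, and fix a connection $(p,q)\in C$ and an index $t$. Define $$P_{pqt}:=\operatorname{conv}\Big\{(w^t_{pi},w^t_{qj},z^t_{pq})\in\{0,1\}^{2|V|+1}:\ \sum_{i\in V}w^t_{pi}=1,\ \sum_{j\in V}w^t_{qj}=1,\ z^t_{pq}=\sum_{(i,j)\in\bar E}w^t_{pi}w^t_{qj}\Big\},$$ $$P^{\le}_{pqt}:=\operatorname{conv}\Big\{(w^t_{pi},w^t_{qj},z^t_{pq})\in\{0,1\}^{2|V|+1}:\ \sum_{i\in V}w^t_{pi}=1,\ \sum_{j\in V}w^t_{qj}=1,\ z^t_{pq}\le\sum_{(i,j)\in\bar E}w^t_{pi}w^t_{qj}\Big\}.$$ Let $V'$ be a copy of $V$ and let $G_{pqt}$ be the bipartite graph with parts $V$ and $V'$ and edge set $E(G_{pqt})=\{(i,j)\in V\times V':\{i,j\}\in E\}$. Consider the constraints $$\text{(a)}\ \sum_{i\in I}w^t_{pi}+\sum_{j\in J}w^t_{qj}=1+z^t_{pq}\quad\text{for all }(I,J)\in B(G_{pqt})\text{ with }E(G_{pqt})=I\times J,$$ $$\text{(b)}\ \sum_{i\in I}w^t_{pi}+\sum_{j\in J}w^t_{qj}\le 1+z^t_{pq}\quad\text{for all }(I,J)\in B(G_{pqt})\text{ with }E(G_{pqt})\ne I\times J,$$ $$\text{(c)}\ \sum_{i\in I}w^t_{pi}+\sum_{j\in J}w^t_{qj}\le 2-z^t_{pq}\quad\text{for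 all }(I,J)\in AB(G_{pqt})\text{ with }E(G_{pqt})\ne (V\setminus I)\times(V'\setminus J).$$ Then $$P_{pqt}=\operatorname{conv}\Big\{(w^t_{pi},w^t_{qj},z^t_{pq})\in[0,1]^{2|V|+1}:\ \sum_{i\in V}w^t_{pi}=1,\ \sum_{j\in V}w^t_{qj}=1,\ \text{(a), (b), (c)}\Big\},$$ $$P^{\le}_{pqt}=\operatorname{conv}\Big\{(w^t_{pi},w^t_{qj},z^t_{pq})\in[0,1]^{2|V|+1}:\ \sum_{i\in V}w^t_{pi}=1,\ \sum_{j\in V}w^t_{qj}=1,\ \text{(a), (c)}\Big\}.$$
   Context: $\bar E$ is the set of arcs containing both $(i,j)$ and $(j,i)$ for each undirected edge $\{i,j\}\in E$. Elements of $V'$ are identified with the corresponding elements of $V$ when used as indices. For a bipartite graph $G$ with parts $X,Y$ and edge set $E(G)\subseteq X\times Y$, a pair $(I,J)$ with $I\subseteq X$, $J\subseteq Y$ is a biclique if $I\times J\subseteq E(G)$ and an antibiclique if $I\times J\subseteq (X\times Y)\setminus E(G)$; $I$ or $J$ may be empty. $B(G)$ (resp. $AB(G)$) is the set of inclusion-maximal bicliques (resp. antibicliques), i.e. those $(I,J)$ for which there is no other biclique (resp. antibiclique) $(I',J')\neq(I,J)$ with $I\subseteq I'$ and $J\subseteq J'$. *)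

(* Defs.v *)
From mathcomp Require Import all_boot all_order all_algebra.
From mathcomp Require Import classical_sets reals convex.

Set Implicit Arguments.
Unset Strict Implicit.
Unset Printing Implicit Defensive.

Import Order.TTheory GRing.Theory Num.Theory.
Local Open Scope ring_scope.

(* A finite simple undirected graph is a set of two-element subsets of its
   vertex type. *)
Definition simple_graph (V : finType) (E : {set {set V}}) : Prop :=
  forall e : {set V}, e \in E -> #|e| = 2%N.

(* Since the edge {i, j} is an unordered pair, (i, j) and (j, i) are both arcs
   as soon as one of them is. *)
Definition arcs (V : finType) (E : {set {set V}}) : {set V * V} :=
  [set a : V * V | [set a.1; a.2]%SET \in E]%SET.

Section Bicliques.
(* The bipartite graph has parts X and Y and edge set F.  Using separate types
   for the parts makes them disjoint even when X and Y are the same type. *)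
Variables (X Y : finType) (F : {set X * Y}).

Definition biclique (K : {set X} * {set Y}) : bool :=
  finset.setX K.1 K.2 \subset F.

Definition antibiclique (K : {set X} * {set Y}) : bool :=
  finset.setX K.1 K.2 \subset (~: F)%SET.

Definition inclusion_maximal (P : pred ({set X} * {set Y}))
    (K : {set X} * {set Y}) : bool :=
  P K && [forall K' : {set X} * {set Y},
    [&& P K', K.1 \subset K'.1 & K.2 \subset K'.2] ==> (K' == K)].

Definition max_bicliques : {set {set X} * {set Y}} :=
  [set K | inclusion_maximal biclique K]%SET.

Definition max_antibicliques : {set {set X} * {set Y}} :=
  [set K | inclusion_maximal antibiclique K]%SET.

End Bicliques.

Definition convex_hull (R : numDomainType) (M : lmodType R) (S : set M) :
    set M := smallest (@convex_set R M) S.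

Section Polytopes.
Variables (R : realType) (V : finType) (E : {set {set V}}).

(* The space R^(2|V|+1) of triples (w^t_p, w^t_q, z^t_pq).  The labels p, q, t
   only name the coordinates. *)
Definition pqt_space : lmodType R :=
  ({ffun V -> R^o} * {ffun V -> R^o} * R^o)%type.

Implicit Type x : pqt_space.

Definition wp x (i : V) : R := x.1.1 i.
Definition wq x (j : V) : R := x.1.2 j.
Definition zpq x : R := x.2.

Definition binary_point x : Prop :=
  [/\ forall i, wp x i = 0 \/ wp x i = 1,
      forall j, wq x j = 0 \/ wq x j = 1
    & zpq x = 0 \/ zpq x = 1].

Definition unit_box_point x : Prop :=
  [/\ forall i, 0 <= wp x i <= 1,
      forall j, 0 <= wq x j <= 1
    & 0 <= zpq x <= 1].

Definition assignment x : Prop :=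
  \sum_(i : V) wp x i = 1 /\ \sum_(j : V) wq x j = 1.

Definition pqt_polytope : set pqt_space :=
  convex_hull [set x : pqt_space |
    [/\ binary_point x, assignment x
      & zpq x = \sum_(a in arcs E) wp x a.1 * wq x a.2]]%classic.

Definition pqt_polytope_le : set pqt_space :=
  convex_hull [set x : pqt_space |
    [/\ binary_point x, assignment x
      & zpq x <= \sum_(a in arcs E) wp x a.1 * wq x a.2]]%classic.

(* The edge set of the bipartite graph with parts V and V', a copy of V. *)
Definition Gpqt : {set V * V} :=
  [set u : V * V | [set u.1; u.2]%SET \in E]%SET.

Definition sum_pair x (K : {set V} * {set V}) : R :=
  \sum_(i in K.1) wp x i + \sum_(j in K.2) wq x j.

Definition constr_a x : Prop :=
  forall K, K \in max_bicliques Gpqt -> Gpqt = finset.setX K.1 K.2 ->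
    sum_pair x K = 1 + zpq x.

Definition constr_b x : Prop :=
  forall K, K \in max_bicliques Gpqt -> Gpqt <> finset.setX K.1 K.2 ->
    sum_pair x K <= 1 + zpq x.

Definition constr_c x : Prop :=
  forall K, K \in max_antibicliques Gpqt ->
    Gpqt <> finset.setX (~: K.1)%SET (~: K.2)%SET ->
    sum_pair x K <= 2 - zpq x.

End Polytopes.

(* Main.v *)
Require Import Defs.
From mathcomp Require Import classical_sets reals convex.
From mathcomp Require Import all_boot all_order all_algebra.
From mathcomp Require Import interval_inference zify ring lra.

Set Implicit Arguments.
Unset Strict Implicit.
Unset Printing Implicit Defensive.

Import Order.TTheory GRing.Theory Num.Theory.
Local Open Scope ring_scope.

(** The binary points of both polytopes are the triples (e_i, e_j, z): the
    assignment equations make each of the two blocks a unit vector, and then the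
    bilinear sum is 1 when (i, j) is an arc and 0 otherwise.  For such a point the
    left-hand sides count how many of i, j lie in the two parts of a biclique or
    of an antibiclique, so every constraint can be read off directly
    ([binary_constraints], [binary_constr_b]).

    Conversely, let x = (u, v, z) satisfy the constraints.  View u and v as
    probability distributions on V.  A coupling g of u and v writes x, up to its
    last coordinate, as the barycenter of the points (e_i, e_j, [(i, j) is an
    arc]) with weights g (i, j), and the last coordinate becomes the mass that g
    puts on the arcs ([coupling_barycenter]).  Hence it suffices to find a
    coupling of mass at least z on the arcs and another one of mass at most z:
    z lies between the two masses, and x on the segment between two points of the
    hull.  For the relaxed polytope every (e_i, e_j, 0) is a generating point, so
    any coupling gives a point with last coordinate 0, which serves as the lower
    end of the segment.

    The largest mass that a coupling can put on a set F of pairs is the least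
    weight u(I) + v(J) of a vertex cover (I, J) of F, a weighted form of Konig's
    theorem ([flow_covers], [coupling_covers]).  The complement of a vertex cover
    of the arcs is an antibiclique, so the bounds 2 - z on antibicliques give
    covers of weight at least z and thus the heavy coupling.  The complement of a
    vertex cover of the non-arcs is a biclique, so the bounds 1 + z on bicliques
    give a coupling of mass at least 1 - z on the non-arcs, which is the light
    one.  Restricting these bounds to inclusion-maximal pairs is harmless because
    u and v are nonnegative.  Finally, the arc set is symmetric and without
    loops, so it is a product I x J only when it is empty; the excluded
    antibicliques therefore occur only in an edgeless graph, where the equations
    (a) force z = 0 ([rectangular_Gpqt_empty], [constr_a_edgeless]). *)

(** * Couplings and vertex covers *)

Section Coupling.
Variables (R : realFieldType) (X Y : finType).
Implicit Types (F : {set X * Y}) (K : {set X} * {set Y}).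
Implicit Types (a : X -> R) (b : Y -> R).

Definition vertex_cover F K : bool :=
  [forall e in F, (e.1 \in K.1) || (e.2 \in K.2)].

(** A cover misses the edges between the complements of its two parts, so the
    complement of a cover is an antibiclique; this turns bounds on antibicliques
    into bounds on covers. *)
Lemma antibiclique_setC F K : vertex_cover F K ->
  antibiclique F ((~: K.1)%SET, (~: K.2)%SET).
Proof.
move=> /forall_inP cK; apply/subsetP=> e; rewrite !inE /= => /andP[e1 e2].
by apply: contraL isT => /cK; rewrite (negPf e1) (negPf e2).
Qed.

Lemma setX_eq0 (I : {set X}) (J : {set Y}) :
  setX I J = finset.set0 -> I = finset.set0 \/ J = finset.set0.
Proof.
move=> IJ0; have [->|[i iI]] := set_0Vmem I; first by left.
have [->|[j jJ]] := set_0Vmem J; first by right.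
have : (i, j) \in setX I J by rewrite inE iI.
by rewrite IJ0 inE.
Qed.

Definition weight a b K : R := \sum_(i in K.1) a i + \sum_(j in K.2) b j.

Lemma weight_submodular a b (I I' : {set X}) (J J' : {set Y}) :
  weight a b (I, J) + weight a b (I', J') =
  weight a b ((I :&: I')%SET, (J :|: J')%SET) +
  weight a b ((I :|: I')%SET, (J :&: J')%SET).
Proof.
have inclexcl (T : finType) (c : T -> R) (S S' : {set T}) :
    \sum_(i in S) c i + \sum_(i in S') c i =
    \sum_(i in S :&: S') c i + \sum_(i in S :|: S') c i.
  rewrite [LHS]addrC (big_mkcond (mem S)) (big_mkcond (mem S')).
  rewrite (big_mkcond (mem (S :&: S'))) (big_mkcond (mem (S :|: S'))).
  rewrite /= -!big_split; apply: eq_bigr => i _ /=; rewrite !inE.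
  by case: (i \in S); case: (i \in S'); rewrite /= ?addr0 ?add0r.
rewrite /weight /= addrACA (inclexcl _ a) (inclexcl _ b).
by rewrite [X in _ + X = _]addrC addrACA.
Qed.

Lemma ler_sum_subset (T : finType) (c : T -> R) (I I' : {set T}) :
  (forall i, 0 <= c i) -> I \subset I' -> \sum_(i in I) c i <= \sum_(i in I') c i.
Proof.
move=> c_ge0 sub; rewrite [leRHS](big_setID I) /= (setIidPr sub) lerDl.
exact: sumr_ge0.
Qed.

Lemma sum_single (T : finType) (S : {set T}) (t0 : T) (d : R) :
  \sum_(t in S) (if t == t0 then d else 0) = if t0 \in S then d else 0.
Proof.
rewrite -big_mkcondr; case: ifP => t0S.
  by rewrite (big_pred1 t0) // => t /=; case: eqP => [->|]; rewrite ?t0S ?andbF.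
by rewrite big_pred0 // => t; case: eqP => [->|]; rewrite ?t0S ?andbF.
Qed.

(** Weighted Konig theorem, by induction on the number of edges.  To delete an edge
    (i0, j0), first route an amount [d] of flow through it and lower the two
    capacities and the target by [d].  For a cover of the remaining edges the
    bound survives unchanged if the cover contains exactly one endpoint; if it
    contains none, [d] must be at least its deficit D - weight; if it contains
    both, [d] must be at most its surplus weight - D.  Submodularity says that
    every deficit is at most every surplus, since from a cover of each kind the
    two lattice combinations are covers of the original edge set; and adding i0
    or j0 to a cover of deficit [d] shows that [d] respects the capacities. *)
Lemma flow_covers F a b (D : R) :
    (forall i, 0 <= a i) -> (forall j, 0 <= b j) ->
    (forall K, vertex_cover F K -> D <= weight a b K) ->
  exists f : X * Y -> R,
    [/\ forall e, 0 <= f e, forall e, e \notin F -> f e = 0,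
        forall i, \sum_j f (i, j) <= a i,
        forall j, \sum_i f (i, j) <= b j & D <= \sum_e f e].
Proof.
have [n] := ubnP #|F|; elim: n F a b D => // n IH F a b D.
have [->|[[i0 j0] e0F]] := set_0Vmem F => leFn a_ge0 b_ge0 coverD.
  exists (fun=> 0); split=> // [i|j|]; rewrite ?big1 //.
  apply: le_trans (coverD (set0, set0) _) _.
    by apply/forall_inP=> e; rewrite inE.
  by rewrite /weight !big_set0 addr0.
pose F' := (F :\ (i0, j0))%SET.
pose neither K := [&& vertex_cover F' K, i0 \notin K.1 & j0 \notin K.2].
(* The endpoint j0 lies in the union on the right, and i0 in the union on the
   left, so both combinations also cover the edge (i0, j0). *)
have cover_mid K K' : vertex_cover F' K -> vertex_cover F' K' ->
    j0 \in K.2 -> i0 \in K.1 ->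
    vertex_cover F ((K.1 :&: K'.1)%SET, (K.2 :|: K'.2)%SET) /\
    vertex_cover F ((K.1 :|: K'.1)%SET, (K.2 :&: K'.2)%SET).
  move=> /forall_inP cK /forall_inP cK' j0K i0K.
  split; apply/forall_inP=> e eF; rewrite /= !inE;
    have [->|ne0] := eqVneq e (i0, j0); rewrite /= ?j0K ?i0K ?orbT //;
    have eF' : e \in F' by rewrite !inE ne0.
  - by have := cK _ eF'; have := cK' _ eF';
      do 4![case: (_ \in _) => //].
  - by have := cK _ eF'; have := cK' _ eF';
      do 4![case: (_ \in _) => //].
have cover_add (K : {set X} * {set Y}) (I : {set X}) (J : {set Y}) :
    vertex_cover F' K -> K.1 \subset I -> K.2 \subset J ->
    (i0 \in I) || (j0 \in J) -> vertex_cover F (I, J).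
  move=> /forall_inP cK /subsetP sI /subsetP sJ e0c.
  apply/forall_inP=> e eF; have [->//|ne0] := eqVneq e (i0, j0).
  have eF' : e \in F' by rewrite !inE ne0.
  by case/orP: (cK _ eF') => [/sI->|/sJ->]; rewrite ?orbT.
(* The least admissible amount: the largest deficit, or 0 if there is none. *)
pose d : R := \big[Num.max/0]_(K | neither K) (D - weight a b K).
have d_ge0 : 0 <= d by apply: bigmax_ge_id.
have d_ge K : neither K -> D - weight a b K <= d.
  by move=> nK; apply: le_bigmax_cond.
have d_lea : d <= a i0.
  apply/bigmax_leP; split=> // K /and3P[cK i0K _].
  have /coverD : vertex_cover F ((i0 |: K.1)%SET, K.2).
    by apply: cover_add cK _ _ _; rewrite ?subsetUr // setU11.
  by rewrite /weight /= big_setU1 //=; lra.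
have d_leb : d <= b j0.
  apply/bigmax_leP; split=> // K /and3P[cK _ j0K].
  have /coverD : vertex_cover F (K.1, (j0 |: K.2)%SET).
    by apply: cover_add cK _ _ _; rewrite ?subsetUr // setU11 orbT.
  by rewrite /weight /= big_setU1 //=; lra.
have d_le K : vertex_cover F' K -> i0 \in K.1 -> j0 \in K.2 ->
    d <= weight a b K - D.
  move=> cK i0K j0K; apply/bigmax_leP; split=> [|K' /and3P[cK' _ _]].
    rewrite subr_ge0; apply: coverD; case: K cK i0K j0K => I J cK i0K j0K.
    by apply: cover_add cK _ _ _; rewrite ?i0K.
  have [/coverD D1 /coverD D2] := cover_mid _ _ cK cK' j0K i0K.
  have := weight_submodular a b K.1 K'.1 K.2 K'.2.
  rewrite -!surjective_pairing; lra.
pose a' i := a i - if i == i0 then d else 0.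
pose b' j := b j - if j == j0 then d else 0.
have weight' K : weight a' b' K = weight a b K
    - (if i0 \in K.1 then d else 0) - (if j0 \in K.2 then d else 0).
  rewrite /weight !sumrB !sum_single; lra.
have [||||f [f_ge0 fF' fa fb fD]] := IH F' a' b' (D - d).
- rewrite -ltnS (leq_trans _ leFn) // ltnS.
  by rewrite [X in (_ < X)%N](cardsD1 (i0, j0)) e0F.
- by move=> i; rewrite /a'; case: eqP => [->|_]; rewrite ?subr0 ?subr_ge0.
- by move=> j; rewrite /b'; case: eqP => [->|_]; rewrite ?subr0 ?subr_ge0.
- move=> [I J] cK; rewrite weight' /=.
  have [i0I|i0I] := boolP (i0 \in I); have [j0J|j0J] := boolP (j0 \in J).
  + by have := d_le _ cK i0I j0J; lra.
  + have /coverD : vertex_cover F (I, J) by apply: cover_add cK _ _ _; rewrite ?i0I.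
    lra.
  + have /coverD : vertex_cover F (I, J).
      by apply: cover_add cK _ _ _; rewrite ?j0J ?orbT.
    lra.
  + by have := d_ge (I, J); rewrite /neither cK i0I j0J => /(_ isT); lra.
exists (fun e => f e + if e == (i0, j0) then d else 0); split=> [e|e eF|i|j|].
- by case: eqP => _; rewrite ?addr0 ?addr_ge0.
- rewrite fF' ?inE ?(negPf eF) ?andbF //; case: eqP => [e0|_]; last by rewrite addr0.
  by rewrite e0 e0F in eF.
- rewrite big_split /=; have := fa i; rewrite /a'.
  have -> : \sum_j (if (i, j) == (i0, j0) then d else 0) =
            if i == i0 then d else 0.
    rewrite (bigD1 j0) //= big1 => [|j /negPf nj]; last first.
      by rewrite xpair_eqE nj andbF.
    by rewrite xpair_eqE eqxx andbT addr0.
  lra.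
- rewrite big_split /=; have := fb j; rewrite /b'.
  have -> : \sum_i (if (i, j) == (i0, j0) then d else 0) =
            if j == j0 then d else 0.
    rewrite (bigD1 i0) //= big1 => [|i /negPf ni]; last first.
      by rewrite xpair_eqE ni.
    by rewrite xpair_eqE eqxx addr0.
  lra.
- rewrite big_split /= -(big_mkcond (pred1 (i0, j0))) /= big_pred1_eq; lra.
Qed.

Definition coupling a b (g : X * Y -> R) : Prop :=
  [/\ forall e, 0 <= g e, forall i, \sum_j g (i, j) = a i
    & forall j, \sum_i g (i, j) = b j].

(** A flow leaves equal total residues [s] in both marginals; adding the
    normalized product of the residues completes it to a coupling and can only
    increase the mass on [F]. *)
Lemma coupling_covers F a b (D : R) :
    (forall i, 0 <= a i) -> (forall j, 0 <= b j) ->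
    \sum_i a i = 1 -> \sum_j b j = 1 ->
    (forall K, vertex_cover F K -> D <= weight a b K) ->
  exists2 g, coupling a b g & D <= \sum_(e in F) g e.
Proof.
move=> a_ge0 b_ge0 a1 b1 /(flow_covers a_ge0 b_ge0)[f [f_ge0 f0 fa fb fD]].
pose a' i := a i - \sum_j f (i, j); pose b' j := b j - \sum_i f (i, j).
pose s := 1 - \sum_e f e.
have a'_ge0 i : 0 <= a' i by rewrite subr_ge0.
have b'_ge0 j : 0 <= b' j by rewrite subr_ge0.
have a's : \sum_i a' i = s.
  by rewrite sumrB a1 pair_bigA /=; congr (_ - _); apply: eq_bigr => -[].
have b's : \sum_j b' j = s.
  rewrite sumrB b1 exchange_big pair_bigA /=; congr (_ - _).
  by apply: eq_bigr => -[].
have s_ge0 : 0 <= s by rewrite -a's sumr_ge0.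
(* When s = 0 the quotient s / s is 0, but then all residues vanish. *)
have res (T : finType) (c : T -> R) t : (forall t, 0 <= c t) -> \sum_t c t = s ->
    c t * (s / s) = c t.
  move=> c_ge0 cs; have [s0|s0] := eqVneq s 0; last by rewrite divff ?mulr1.
  have /eqP := cs; rewrite s0 psumr_eq0 // => /allP/(_ t).
  by rewrite mem_index_enum => /(_ isT)/eqP->; rewrite mul0r.
exists (fun e => f e + a' e.1 * b' e.2 / s).
  split=> [e|i|j].
  - by rewrite addr_ge0 // divr_ge0 // mulr_ge0.
  - rewrite big_split /= -mulr_suml -mulr_sumr b's -mulrA res //.
    by rewrite addrC subrK.
  - rewrite big_split /= -!mulr_suml a's.
    by rewrite mulrC [s * _]mulrC mulrCA [_^-1 * _]mulrC res // addrC subrK.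
apply: le_trans fD _; rewrite (bigID (mem F)) /= [X in _ + X]big1 ?addr0 //.
by apply: ler_sum => e _; rewrite lerDl divr_ge0 // mulr_ge0.
Qed.

End Coupling.

(** * Extension to inclusion-maximal pairs *)

Section Maximal.
Variables (X Y : finType) (P : pred ({set X} * {set Y})).

Lemma sub_inclusion_maximal K : P K ->
  exists2 K', inclusion_maximal P K' & (K.1 \subset K'.1) && (K.2 \subset K'.2).
Proof.
move=> PK.
pose above (L : {set X} * {set Y}) :=
  [&& P L, K.1 \subset L.1 & K.2 \subset L.2].
have aboveK : above K by rewrite /above PK !subxx.
pose size (L : {set X} * {set Y}) := (#|L.1| + #|L.2|)%N.
case: (arg_maxnP size aboveK) => L /and3P[PL KL1 KL2] Lmax.
exists L; last by rewrite KL1.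
rewrite /inclusion_maximal PL; apply/forallP=> M; apply/implyP.
case/and3P=> PM LM1 LM2.
have /Lmax : above M by rewrite /above PM (subset_trans KL1) ?(subset_trans KL2).
rewrite /size /= => le.
have eq1 : L.1 = M.1.
  apply/eqP; rewrite eqEcard LM1 /=; have := subset_leq_card LM2; lia.
have eq2 : L.2 = M.2.
  apply/eqP; rewrite eqEcard LM2 /=; have := subset_leq_card LM1; lia.
by rewrite [L]surjective_pairing [M]surjective_pairing eq1 eq2.
Qed.

End Maximal.

(** * Convex hulls *)

Section Convexity.
Variables (R : realFieldType) (M : lmodType R).
Implicit Types (A S T : set M) (x y : M).

Lemma convex_set_comb A x y (l : R) :
  convex_set A -> A x -> A y -> 0 <= l -> l <= 1 -> A (l *: x + (1 - l) *: y).
Proof.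
move=> cA Ax Ay l0 l1; apply: set_mem.
exact: (cA _ _ (Itv01 l0 l1) (mem_set Ax) (mem_set Ay)).
Qed.

Lemma convex_set_sum A (I : finType) (c : I -> R) (v : I -> M) :
    convex_set A -> (forall i, 0 <= c i) -> \sum_i c i = 1 ->
    (forall i, A (v i)) ->
  A (\sum_i c i *: v i).
Proof.
move=> cA c_ge0 c1 Av.
have [i0 _|I0] := pickP (@predT I); last first.
  by move: c1 => /esym/eqP; rewrite big_pred0 // oner_eq0.
(* Stating that each partial sum is its total weight times a point of A avoids
   normalizing by weights that may vanish. *)
suff [_ [y Ay ->]] : 0 <= \sum_i c i /\
    exists2 y, A y & \sum_i c i *: v i = (\sum_i c i) *: y.
  by rewrite c1 scale1r.
apply: (big_rec2 (fun (u : M) (s : R) => 0 <= s /\ exists2 y, A y & u = s *: y)).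
  by split=> //; exists (v i0); last exact: esym (scale0r _).
move=> i _ s _ [s0 [y Ay ->]]; split; first by rewrite addr_ge0.
have [e0|ne0] := eqVneq (c i + s) 0.
  have [ci s'] : c i = 0 /\ s = 0 by have := c_ge0 i; split; lra.
  by exists y => //; rewrite ci s' addr0 !scale0r addr0.
have gt0 : 0 < c i + s by rewrite lt_neqAle eq_sym ne0 addr_ge0.
exists (c i / (c i + s) *: v i + (1 - c i / (c i + s)) *: y).
  apply: convex_set_comb => //; first by rewrite divr_ge0 // ltW.
  by rewrite ler_pdivrMr // mul1r lerDl.
rewrite scalerDr !scalerA mulrBr mulr1 mulrCA divff // mulr1.
by rewrite addrAC subrr add0r.
Qed.

(** The second hypothesis says that T lies in the hull of S, phrased with an
    arbitrary convex set so that it can be used with closure properties of A. *)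
Lemma eq_convex_hull S T :
    (forall x, S x -> T x) ->
    (forall A, convex_set A -> (forall x, S x -> A x) -> forall x, T x -> A x) ->
  convex_hull S = convex_hull T.
Proof.
move=> ST TA; apply/seteqP; split=> x hx A [cA sA]; apply: hx; split=> //.
- by move=> y /ST /sA.
- exact: TA.
Qed.

End Convexity.

(** * Binary points and barycenters *)

Section Points.
Variables (R : realType) (V : finType) (E : {set {set V}}).
Implicit Types (x : pqt_space R V) (K : {set V} * {set V}).

Definition vertex_pair (e : V * V) (z : R) : pqt_space R V :=
  ([ffun k => (k == e.1)%:R], [ffun k => (k == e.2)%:R], z).

Lemma sum_indicator (S : {set V}) i :
  \sum_(k in S) (k == i)%:R = (i \in S)%:R :> R.
Proof.
rewrite -[RHS](_ : (if i \in S then 1 else 0) = _); last by case: ifP.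
by rewrite -sum_single; apply: eq_bigr => k _; case: eqP.
Qed.

Lemma sum_pair_vertex_pair e z K :
  sum_pair (vertex_pair e z) K = (e.1 \in K.1)%:R + (e.2 \in K.2)%:R.
Proof.
rewrite /sum_pair -!sum_indicator.
by congr (_ + _); apply: eq_bigr => k _; rewrite /wp /wq /= ffunE.
Qed.

Lemma arcs_vertex_pair e z :
  \sum_(u in arcs E) wp (vertex_pair e z) u.1 * wq (vertex_pair e z) u.2 =
  (e \in arcs E)%:R.
Proof.
rewrite -[RHS](_ : (if e \in arcs E then 1 else 0) = _); last by case: ifP.
rewrite -sum_single; apply: eq_bigr => u _; rewrite /wp /wq /= !ffunE.
case: u e => i j [i0 j0]; rewrite xpair_eqE /=.
by case: eqP; case: eqP; rewrite /= ?mulr1 ?mulr0.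
Qed.

Lemma binary_vertex_pair e z : z = 0 \/ z = 1 ->
  binary_point (vertex_pair e z) /\ assignment (vertex_pair e z).
Proof.
have sum1 (i : V) : \sum_k (k == i)%:R = 1 :> R.
  by rewrite (bigD1 i) //= eqxx big1 ?addr0 // => k /negPf->.
move=> z01; split; split=> //.
- by move=> i; rewrite /wp ffunE; case: eqP; [right|left].
- by move=> i; rewrite /wq ffunE; case: eqP; [right|left].
- by rewrite -[RHS](sum1 e.1); apply: eq_bigr => k _; rewrite /wp ffunE.
- by rewrite -[RHS](sum1 e.2); apply: eq_bigr => k _; rewrite /wq ffunE.
Qed.

Lemma binary_sum1 (c : V -> R) :
    (forall i, c i = 0 \/ c i = 1) -> \sum_i c i = 1 ->
  exists i0, forall i, c i = (i == i0)%:R.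
Proof.
move=> c01 c1.
have c_ge0 i : 0 <= c i by case: (c01 i) => ->.
have [/existsP[i0 /eqP ci0]|/existsPn nc] := boolP [exists i, c i == 1]; last first.
  move: c1; rewrite big1 => [/esym/eqP|i _]; first by rewrite oner_eq0.
  by case: (c01 i) => // /eqP; rewrite (negPf (nc i)).
exists i0 => i; have [->|ni] := eqVneq i i0; first by [].
have := c1; rewrite (bigD1 i0) //= (bigD1 i) //= ci0.
have : 0 <= \sum_(k | (k != i0) && (k != i)) c k by apply: sumr_ge0.
by have := c_ge0 i; lra.
Qed.

Lemma binary_assignmentP x : binary_point x -> assignment x ->
  exists e z, x = vertex_pair e z.
Proof.
move=> [p01 q01 _] [/(binary_sum1 p01)[i0 pE] /(binary_sum1 q01)[j0 qE]].
case: x p01 q01 pE qE => -[w v] z _ _ pE qE; exists (i0, j0), z.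
rewrite /vertex_pair /=; congr (_, _, _); apply/ffunP=> k; rewrite ffunE.
- exact: pE.
- exact: qE.
Qed.

(** The two marginal conditions are exactly the equalities of the first two
    blocks of coordinates. *)
Lemma coupling_barycenter x (g h : V * V -> R) :
    coupling (wp x) (wq x) g -> zpq x = \sum_e g e * h e ->
  x = \sum_e g e *: vertex_pair e (h e).
Proof.
move=> [_ gp gq] zE; rewrite [LHS]surjective_pairing [RHS]surjective_pairing.
rewrite [x.1]surjective_pairing [(\sum_e _).1]surjective_pairing.
have fstS (U W : lmodType R) (v : V * V -> U * W) : (\sum_e v e).1 = \sum_e (v e).1.
  exact: (big_morph fst (id1 := 0) (op1 := +%R)).
have sndS (U W : lmodType R) (v : V * V -> U * W) : (\sum_e v e).2 = \sum_e (v e).2.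
  exact: (big_morph snd (id1 := 0) (op1 := +%R)).
have pairS (F : V * V -> R) : \sum_e F e = \sum_i \sum_j F (i, j).
  by rewrite pair_bigA; apply: eq_bigr => -[].
congr (_, _, _).
- rewrite !fstS; apply/ffunP=> k; rewrite sum_ffunE.
  rewrite pairS (bigD1 k) //= [X in _ = _ + X]big1 ?addr0 => [|i ik].
    rewrite -[LHS]/(wp x k) -gp; apply: eq_bigr => j _.
    by rewrite !ffunE eqxx [RHS]mulr1.
  by rewrite big1 // => j _; rewrite !ffunE eq_sym (negPf ik) scaler0.
- rewrite fstS sndS; apply/ffunP=> k; rewrite sum_ffunE.
  rewrite pairS exchange_big (bigD1 k) //= [X in _ = _ + X]big1 ?addr0 => [|j jk].
    rewrite -[LHS]/(wq x k) -gq; apply: eq_bigr => i _.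
    by rewrite !ffunE eqxx [RHS]mulr1.
  by rewrite big1 // => i _; rewrite !ffunE eq_sym (negPf jk) scaler0.
- by rewrite sndS -[LHS]/(zpq x).
Qed.

End Points.

(** * Validity and sufficiency of the constraints *)

Section Inclusions.
Variables (R : realType) (V : finType) (E : {set {set V}}).
Implicit Types (x : pqt_space R V) (K : {set V} * {set V}).

(** If (i, j) is in I x J, so is (j, i) by symmetry of the edge relation; then j
    is in both I and J, and the product contains the loop (j, j). *)
Lemma rectangular_Gpqt_empty (I J : {set V}) :
  simple_graph E -> Gpqt E = setX I J -> Gpqt E = finset.set0.
Proof.
move=> simpleE GE; apply/setP=> -[i j]; rewrite !inE /=.
apply/negP=> ijE.
have : (i, j) \in Gpqt E by rewrite inE.
have : (j, i) \in Gpqt E by rewrite inE setUC.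
rewrite GE !inE /= => /andP[jI _] /andP[_ jJ].
have : (j, j) \in Gpqt E by rewrite GE !inE jI.
by rewrite inE /= setUid => /simpleE; rewrite cards1.
Qed.

(** The equality constraints (a) only matter without edges: then a maximal
    biclique is V with the empty set, in one order or the other, whose left-hand side is 1, and z = 0. *)
Lemma binary_constraints x :
    simple_graph E -> binary_point x -> assignment x ->
    zpq x <= \sum_(a in arcs E) wp x a.1 * wq x a.2 ->
  [/\ unit_box_point x, constr_a E x & constr_c E x].
Proof.
move=> simpleE xbin xasg.
have xbox : unit_box_point x.
  by case: xbin => p01 q01 z01; split=> [i|j|];
    [case: (p01 i)|case: (q01 j)|case: z01] => ->; rewrite ?lexx ?ler01.
have [e [z xE]] := binary_assignmentP xbin xasg; subst x.
rewrite arcs_vertex_pair /zpq /= => ze.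
have [_ _ /andP[]] := xbox; rewrite /zpq /= => z_ge0 z_le1.
split=> // [K maxK GE|K + _]; rewrite sum_pair_vertex_pair /zpq /=.
  have G0 := rectangular_Gpqt_empty simpleE GE.
  have -> : z = 0.
    by apply/le_anti; rewrite z_ge0 (le_trans ze) // -[arcs E]/(Gpqt E) G0 inE.
  move: maxK; rewrite inE => /andP[_ /forallP maxK].
  have fullK L : setX L.1 L.2 = finset.set0 -> K.1 \subset L.1 ->
      K.2 \subset L.2 -> L = K.
    move=> L0 s1 s2; apply/eqP; move/implyP: (maxK L); apply.
    by rewrite s1 s2 /biclique L0 sub0set.
  have [K0|K0] := setX_eq0 (etrans (esym GE) G0).
  - have <- := fullK (finset.set0, setT); rewrite ?inE ?addr0 ?add0r ?K0 ?subsetT //.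
    by apply/setP=> -[i j]; rewrite !inE.
  - have <- := fullK (setT, finset.set0); rewrite ?inE ?addr0 ?add0r ?K0 ?subsetT //.
    by apply/setP=> -[i j]; rewrite !inE andbF.
rewrite inE => /andP[/subsetP antiK _].
move: ze; have [e1|_] := boolP (e.1 \in K.1); have [e2|_] := boolP (e.2 \in K.2);
  rewrite /= ?mulr0n ?mulr1n; try lra.
have : e \in (~: Gpqt E)%SET by apply: antiK; rewrite !inE e1.
by rewrite inE => /negPf; rewrite -[Gpqt E]/(arcs E) => -> /=; lra.
Qed.

Lemma binary_constr_b x :
    binary_point x -> assignment x ->
    zpq x = \sum_(a in arcs E) wp x a.1 * wq x a.2 ->
  constr_b E x.
Proof.
move=> xbin xasg; have [e [z xE]] := binary_assignmentP xbin xasg; subst x.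
rewrite arcs_vertex_pair => ze K + _; rewrite sum_pair_vertex_pair ze.
rewrite inE => /andP[/subsetP biK _].
have [e1|_] := boolP (e.1 \in K.1); have [e2|_] := boolP (e.2 \in K.2);
  rewrite ?addr0 ?add0r ?lerDl ?ler0n //.
  have -> : e \in arcs E by apply: biK; rewrite inE e1.
  by [].
by rewrite addr_ge0 ?ler0n.
Qed.

Lemma sum_pair_le x K K' : unit_box_point x ->
  (K.1 \subset K'.1) && (K.2 \subset K'.2) -> sum_pair x K <= sum_pair x K'.
Proof.
move=> [p01 q01 _] /andP[s1 s2].
by apply: lerD; apply: ler_sum_subset => // i;
  [case/andP: (p01 i)|case/andP: (q01 i)].
Qed.

(** Every maximal biclique is bounded, by the equation (a) or the inequality (b)
    according to whether it exhausts the edges. *)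
Lemma biclique_constraint x K :
    unit_box_point x -> constr_a E x -> constr_b E x -> biclique (Gpqt E) K ->
  sum_pair x K <= 1 + zpq x.
Proof.
move=> xbox xa xb /sub_inclusion_maximal[K' maxK' sub].
apply: le_trans (sum_pair_le xbox sub) _.
have K'in : K' \in max_bicliques (Gpqt E) by rewrite inE.
have [GE|/eqP GE] := eqVneq (Gpqt E) (setX K'.1 K'.2).
  by rewrite (xa _ K'in GE).
exact: xb.
Qed.

Lemma sum_pair_setT x : assignment x -> sum_pair x (setT, setT) = 2.
Proof.
move=> [p1 q1]; rewrite /sum_pair /=.
under eq_bigl do rewrite inE.
under [X in _ + X]eq_bigl do rewrite inE.
by rewrite p1 q1.
Qed.

(** Without edges, V with the empty set is a maximal biclique, as V is nonempty,
    and its equation reads 1 = 1 + z. *)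
Lemma constr_a_edgeless x :
    unit_box_point x -> assignment x -> constr_a E x ->
    Gpqt E = finset.set0 ->
  zpq x <= 0.
Proof.
move=> xbox xasg xa G0.
have [|K maxK /andP[sK _]] :=
    @sub_inclusion_maximal _ _ (biclique (Gpqt E)) (setT, finset.set0).
  by apply/subsetP=> -[i j]; rewrite !inE andbF.
have K1 : K.1 = setT by apply/eqP; rewrite -subTset.
have GK : setX K.1 K.2 = finset.set0.
  by apply/eqP; rewrite -subset0 -G0; case/andP: maxK.
have := xa K; rewrite inE GK => /(_ maxK G0); rewrite /sum_pair K1.
have -> : \sum_(i in setT) wp x i = 1.
  by under eq_bigl do rewrite inE; case: xasg.
case: (setX_eq0 GK) => K0; last by rewrite K0 big_set0; lra.
have [p1 _] := xasg; move: p1; rewrite big1 => [/eqP|i _].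
  by rewrite eq_sym oner_eq0.
have : i \in K.1 by rewrite K1 inE.
by rewrite K0 inE.
Qed.

(** A maximal antibiclique left out of (c) exists only without edges, and then
    z = 0 makes the bound 2 trivial. *)
Lemma antibiclique_constraint x K :
    simple_graph E -> unit_box_point x -> assignment x ->
    constr_a E x -> constr_c E x -> antibiclique (Gpqt E) K ->
  sum_pair x K <= 2 - zpq x.
Proof.
move=> simpleE xbox xasg xa xc /sub_inclusion_maximal[K' maxK' sub].
apply: le_trans (sum_pair_le xbox sub) _.
have K'in : K' \in max_antibicliques (Gpqt E) by rewrite inE.
have [GE|/eqP GE] := eqVneq (Gpqt E) (setX (~: K'.1) (~: K'.2)); last exact: xc.
have := constr_a_edgeless xbox xasg xa (rectangular_Gpqt_empty simpleE GE).
have := @sum_pair_le x K' (setT, setT) xbox; rewrite !subsetT => /(_ isT).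
by rewrite sum_pair_setT //; lra.
Qed.

Lemma sum_pairC x K : assignment x ->
  sum_pair x K = 2 - sum_pair x ((~: K.1)%SET, (~: K.2)%SET).
Proof.
move=> xasg; rewrite -(sum_pair_setT xasg).
have := weight_submodular (wp x) (wq x) K.1 (~: K.1)%SET K.2 (~: K.2)%SET.
rewrite !setICr !setUCr /weight /sum_pair /= !big_set0; lra.
Qed.

Lemma coupling_heavy x :
    simple_graph E -> unit_box_point x -> assignment x ->
    constr_a E x -> constr_c E x ->
  exists2 g, coupling (wp x) (wq x) g & zpq x <= \sum_(e in arcs E) g e.
Proof.
move=> simpleE xbox xasg xa xc.
have [p01 q01 _] := xbox; have [p1 q1] := xasg.
apply: coupling_covers => // [i|j|K coverK].
- by case/andP: (p01 i).
- by case/andP: (q01 j).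
rewrite -[weight _ _ _]/(sum_pair x K) sum_pairC // lerBrDr -lerBrDl.
exact/antibiclique_constraint/antibiclique_setC.
Qed.

(** The light coupling on the arcs is the heavy one on their complement, whose
    vertex covers are the complements of bicliques. *)
Lemma coupling_light x :
    unit_box_point x -> assignment x -> constr_a E x -> constr_b E x ->
  exists2 g, coupling (wp x) (wq x) g & \sum_(e in arcs E) g e <= zpq x.
Proof.
move=> xbox xasg xa xb.
have [p01 q01 _] := xbox; have [p1 q1] := xasg.
have [||||K coverK|g gc gD] :=
  @coupling_covers R V V (~: arcs E)%SET (wp x) (wq x) (1 - zpq x) => //.
- by move=> i; case/andP: (p01 i).
- by move=> j; case/andP: (q01 j).
- have biK : biclique (Gpqt E) ((~: K.1)%SET, (~: K.2)%SET).
    by have := antibiclique_setC coverK; rewrite /antibiclique setCK.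
  have := biclique_constraint xbox xa xb biK.
  by rewrite -[weight _ _ _]/(sum_pair x K) (sum_pairC K xasg); lra.
exists g => //; have [_ gp _] := gc.
have : \sum_e g e = 1.
  by rewrite -p1 -(eq_bigr _ (fun i _ => gp i)) pair_bigA; apply: eq_bigr => -[].
rewrite (bigID (mem (arcs E))) /=.
by under [X in _ + X]eq_bigl do rewrite -in_setC; move: gD => /=; lra.
Qed.

Lemma coupling_mem (A : set (pqt_space R V)) (w v : {ffun V -> R^o})
    (g h : V * V -> R) :
    convex_set A -> (forall e, A (vertex_pair e (h e))) ->
    \sum_i w i = 1 ->
    coupling (w : V -> R) (v : V -> R) g ->
  A (w, v, \sum_e g e * h e).
Proof.
move=> cA Av w1 gc; rewrite (coupling_barycenter (x := (w, v, _)) gc (erefl _)).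
have [g_ge0 gp _] := gc; apply: convex_set_sum => //.
by rewrite -w1 -(eq_bigr _ (fun i _ => gp i)) pair_bigA; apply: eq_bigr => -[].
Qed.

Lemma convex_set_between (A : set (pqt_space R V)) w z1 z z2 :
  convex_set A -> A (w, z1) -> A (w, z2) -> z1 <= z <= z2 -> A (w, z).
Proof.
move=> cA A1 A2 /andP[z1z zz2].
have [e12|n12] := eqVneq z1 z2; first by rewrite (_ : z = z1) //; lra.
have d0 : 0 < z2 - z1 by rewrite subr_gt0 lt_neqAle n12 (le_trans z1z).
have := convex_set_comb (l := (z2 - z) / (z2 - z1)) cA A1 A2.
have -> : (z2 - z) / (z2 - z1) *: ((w, z1) : pqt_space R V)
    + (1 - (z2 - z) / (z2 - z1)) *: ((w, z2) : pqt_space R V) = (w, z).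
  congr (_, _).
    by rewrite -[LHS]/(_ *: w + _ *: w) -scalerDl addrC subrK scale1r.
  rewrite -[LHS]/(_ * z1 + _ * z2); field.
  by rewrite subr_eq0 eq_sym.
apply; first by rewrite divr_ge0 ?subr_ge0 // (le_trans z1z).
by rewrite ler_pdivrMr // mul1r; lra.
Qed.

End Inclusions.

Theorem corollary4p2 (R : realType)
    (V : finType) (E : {set {set V}}) (Q : finType) (C : {set {set Q}})
    (T : Type) (p q : Q) (t : T)
    (simpleH : simple_graph E) (simpleA : simple_graph C)
    (cardVQ : #|V| = #|Q|) (pq_connection : [set p; q]%SET \in C) :
  @pqt_polytope R V E =
    convex_hull [set x : pqt_space R V |
      [/\ unit_box_point x, assignment x,
          constr_a E x, constr_b E x & constr_c E x]]%classic
  /\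
  @pqt_polytope_le R V E =
    convex_hull [set x : pqt_space R V |
      [/\ unit_box_point x, assignment x,
          constr_a E x & constr_c E x]]%classic.
Proof.
have arcs_sum (g : V * V -> R) :
    \sum_e g e * (e \in arcs E)%:R = \sum_(e in arcs E) g e.
  rewrite [RHS]big_mkcond; apply: eq_bigr => e _.
  by case: (e \in _); rewrite ?mulr1 ?mulr0.
have bin01 (b : bool) : b%:R = 0 :> R \/ b%:R = 1 :> R by case: b; [right|left].
split; apply: eq_convex_hull => [x|A cA sA x].
- move=> [xbin xasg zE].
  have [|xbox xa xc] := binary_constraints simpleH xbin xasg; first by rewrite zE.
  by split=> //; apply: binary_constr_b.
- have vA e : A (vertex_pair e (e \in arcs E)%:R).
    apply: sA; have [vb va] := binary_vertex_pair e (bin01 (e \in arcs E)).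
    by split=> //; rewrite arcs_vertex_pair.
  move=> [xbox xasg xa xb xc].
  have [g gc gz] := coupling_heavy simpleH xbox xasg xa xc.
  have [g' gc' gz'] := coupling_light xbox xasg xa xb.
  have := coupling_mem cA vA xasg.1 gc; have := coupling_mem cA vA xasg.1 gc'.
  rewrite !arcs_sum; case: x gz gz' {xbox xasg xa xb xc gc gc'} => -[w v] z gz gz'.
  by move=> A1 A2; apply: (convex_set_between cA A1 A2); apply/andP.
- by move=> [xbin xasg zE]; have [] := binary_constraints simpleH xbin xasg zE.
- have vA e : A (vertex_pair e (e \in arcs E)%:R).
    apply: sA; have [vb va] := binary_vertex_pair e (bin01 (e \in arcs E)).
    by split=> //; rewrite arcs_vertex_pair.
  have vA0 e : A (vertex_pair e 0).
    apply: sA; have [vb va] := binary_vertex_pair e (bin01 false).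
    by split=> //; rewrite arcs_vertex_pair ler0n.
  move=> [xbox xasg xa xc].
  have [g gc gz] := coupling_heavy simpleH xbox xasg xa xc.
  have := coupling_mem cA vA xasg.1 gc; have := coupling_mem cA vA0 xasg.1 gc.
  rewrite arcs_sum big1 => [|e _]; last by rewrite mulr0.
  have [_ _ /andP[z0 _]] := xbox.
  case: x gz z0 {xbox xasg xa xc gc} => -[w v] z gz z0.
  by move=> A1 A2; apply: (convex_set_between cA A1 A2); apply/andP.
Qed.
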